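(* Let $A$ be a Hopf algebra, $B$ a braided Hopf algebra in the category $\mathcal M^A_A$ of right $A$-crossed modules, $\Omega(A)$ a strongly bicovariant exterior algebra on $A$ and $\Omega(B)$ a braided strongly bicovariant exterior algebra in $\mathcal M^{\Omega(A)}_{\Omega(A)}$, and let $A\rtimes B$ have the exterior algebra $\Omega(A\rtimes B):=\Omega(A)\rtimes\Omega(B)$ given by the super bosonisation with $d(\omega\otimes\eta)=d_A\omega\otimes\eta+(-1)^{|\omega|}\omega\otimes d_B\eta$. Then the canonical right coaction $\Delta_R:B\to B\otimes(A\rtimes B)$, $\Delta_Rb=b_{\underline{(1)}}{}^{(0)}\otimes b_{\underline{(1)}}{}^{(1)}\otimes b_{\underline{(2)}}$, is differentiable.
   Context: Work over a field $k$; Hopf algebras $A$ have invertible antipode. An exterior algebra on an algebra $A$ is a differential graded algebra $\Omega(A)=\oplus_{n\ge0}\Omega^n(A)$ with $\Omega^0=A$, generated by $A$ and $\Omega^1=\mathrm{span}\{a\,db\}$, with $d^2=0$ and graded Leibniz rule. The super tensor product $\underline\otimes$ has product $(a\otimes b)(c\otimes d)=(-1)^{|b||c|}ac\otimes bd$ and differential $d\otimes\mathrm{id}+(-1)^{|\ |}\mathrm{id}\otimes d$. $\Omega(A)$ is strongly bicovariant if it is a super-Hopf algebra (grade = form degree mod 2) with coproduct $\Delta_*$ preserving total degree, restricting to $\Delta$ on $A$, and obeying the super-coderivation property $\Delta_*d\omega=(d\otimes\mathrm{id}+(-1)^{|\ |}\mathrm{id}\otimes d)\Delta_*\omega$. A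 right coaction $\Delta_R:B\to B\otimes K$ making $B$ a $K$-comodule algebra is differentiable (for exterior algebras $\Omega(B)$, $\Omega(K)$) if it extends to a total-degree-preserving DGA map $\Delta_{R*}:\Omega(B)\to\Omega(B)\underline\otimes\Omega(K)$. For a super-Hopf algebra $K$ (an ordinary Hopf algebra being the case concentrated in degree 0), a super right $K$-crossed module is a super right $K$-module and comodule $V$ (coaction $v\mapsto v^{(0)}\otimes v^{(1)}$) with $$\Delta_R(v\triangleleft a)=(-1)^{|v^{(1)}|(|a_{(1)}|+|a_{(2)}|)+|a_{(1)}||a_{(2)}|}v^{(0)}\triangleleft a_{(2)}\otimes(Sa_{(1)})v^{(1)}a_{(3)}.$$ These form the category $\mathcal M^K_K$ with braiding $\Psi(v\otimes w)=(-1)^{|v||w^{(0)}|}w^{(0)}\otimes(v\triangleleft w^{(1)})$. A (super) braided Hopf algebra $B$ in it is an algebra (a super $K$-module algebra and $K$-comodule algebra) with coproduct $\underline\Delta b=b_{\underline{(1)}}\otimes b_{\underline{(2)}}$, counit and antipode which are morphisms, satisfying the Hopf algebra axioms with $\underline\Delta(bc)=b_{\underline{(1)}}\Psi(b_{\underline{(2)}}\otimes c_{\underline{(1)}})c_{\underline{(2)}}$. $\Omega(B)$ is braided strongly bicovariant if: the coaction of $A$ on $B$ ($b\mapsto b^{(0)}\otimes b^{(1)}$) is differentiable with extension $\Omega(B)\to\Omega(B)\underline\otimes\Omega(A)$, $\eta\mapsto\eta^{(0)}\otimes\eta^{(1)}$; $A$ acts on $\Omega(B)$ making it an algebra in $\mathcal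 M^A_A$, and this action extends to a degree-preserving $\triangleleft:\Omega(B)\underline\otimes\Omega(A)\to\Omega(B)$ making $\Omega(B)$ a super $\Omega(A)$-module algebra with $d_B(\eta\triangleleft\omega)=(d_B\eta)\triangleleft\omega+(-1)^{|\eta|}\eta\triangleleft d_A\omega$; $B$ is a braided Hopf algebra in $\mathcal M^A_A$; and $\underline\Delta$ extends to a degree-preserving $\underline\Delta_*$ making $\Omega(B)$ a super braided-Hopf algebra in $\mathcal M^{\Omega(A)}_{\Omega(A)}$ with $\underline\Delta_*d_B=(d_B\otimes\mathrm{id}+(-1)^{|\ |}\mathrm{id}\otimes d_B)\underline\Delta_*$. The biproduct $A\rtimes B$ is $A\otimes B$ with $(a\otimes b)(c\otimes d)=ac_{(1)}\otimes(b\triangleleft c_{(2)})d$ and $\Delta(a\otimes b)=a_{(1)}\otimes b_{\underline{(1)}}^{(0)}\otimes a_{(2)}b_{\underline{(1)}}^{(1)}\otimes b_{\underline{(2)}}$. The super bosonisation $\Omega(A)\rtimes\Omega(B)$ is $\Omega(A)\otimes\Omega(B)$ with $$(\omega\otimes\eta)(\tau\otimes\xi)=(-1)^{|\eta||\tau_{(1)}|}\omega\tau_{(1)}\otimes(\eta\triangleleft\tau_{(2)})\xi,\qquad\Delta_*(\omega\otimes\eta)=(-1)^{|\omega_{(2)}||\eta_{\underline{(1)}}^{(0)}|}\omega_{(1)}\otimes\eta_{\underline{(1)}}^{(0)}\otimes\omega_{(2)}\eta_{\underline{(1)}}^{(1)}\otimes\eta_{\underline{(2)}}.$$ *)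

(* Defs.v *)
From HB Require Import structures.
From mathcomp Require Import all_boot all_order all_algebra.
From mathcomp Require Import boolp.

Set Implicit Arguments.
Unset Strict Implicit.
Unset Printing Implicit Defensive.

Import GRing.Theory.
Local Open Scope ring_scope.
Local Open Scope quotient_scope.

(** * Tensor product of two k-vector spaces

    Elements are classes of formal sums v_1 (x) w_1 + ... + v_n (x) w_n, two
    such sums being identified when no bilinear map separates them; this is the
    quotient of the free vector space on V * W by the bilinearity relations.
    The universal property is given by [tlift], [tliftE] and [tens_ext]. *)
Section Tensor.
Variables (k : fieldType) (V W : lmodType k).

Definition bsum (U : lmodType k) (f : V -> W -> U) (s : seq (V * W)) : U :=
  \sum_(p <- s) f p.1 p.2.

Definition teq : rel (seq (V * W)) := fun s t =>
  `[< forall (U : lmodType k) (f : {bilinear V -> W -> U}),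
        bsum f s = bsum f t >].

Lemma teq_refl : reflexive teq.
Proof. by move=> s; apply/asboolP. Qed.
Lemma teq_sym : symmetric teq.
Proof. by move=> s t; apply/asboolP/asboolP => h U f; rewrite h. Qed.
Lemma teq_trans : transitive teq.
Proof.
by move=> t s u /asboolP h1 /asboolP h2; apply/asboolP => U f; rewrite h1 h2.
Qed.

Canonical teq_equiv := EquivRel teq teq_refl teq_sym teq_trans.

Definition tens := {eq_quot teq}.
HB.instance Definition _ := Choice.on tens.
HB.instance Definition _ := EqQuotient.on tens.

Lemma tensP s t : reflect
  (forall (U : lmodType k) (f : {bilinear V -> W -> U}), bsum f s = bsum f t)
  (\pi_tens s == \pi_tens t).
Proof. by rewrite eqmodE; apply: asboolP. Qed.

Lemma pi_tensP s t :
  (forall (U : lmodType k) (f : {bilinear V -> W -> U}), bsum f s = bsum f t) ->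
  \pi_tens s = \pi_tens t.
Proof. by move=> h; apply/eqP/tensP. Qed.

Lemma bsum_repr s (U : lmodType k) (f : {bilinear V -> W -> U}) :
  bsum f (repr (\pi_tens s)) = bsum f s.
Proof. by apply/(tensP _ _) : U f; rewrite reprK. Qed.

Lemma bsum_cat (U : lmodType k) (f : V -> W -> U) s t :
  bsum f (s ++ t) = bsum f s + bsum f t.
Proof. by rewrite /bsum big_cat. Qed.

Lemma bsum_scale a (U : lmodType k) (f : {bilinear V -> W -> U}) s :
  bsum f [seq (a *: p.1, p.2) | p <- s] = a *: bsum f s.
Proof.
by rewrite /bsum big_map scaler_sumr; apply: eq_bigr => p _; rewrite linearZl_LR.
Qed.

Definition tadd (x y : tens) : tens := \pi_tens (repr x ++ repr y).
Definition tscale (a : k) (x : tens) : tens :=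
  \pi_tens [seq (a *: p.1, p.2) | p <- repr x].
Definition topp (x : tens) : tens := tscale (-1) x.
Definition tzero : tens := \pi_tens [::].

Lemma tens_reprP (x y : tens) :
  (forall (U : lmodType k) (f : {bilinear V -> W -> U}),
     bsum f (repr x) = bsum f (repr y)) -> x = y.
Proof. by move=> h; rewrite -[x]reprK -[y]reprK; apply: pi_tensP. Qed.

Let simp := (bsum_repr, bsum_cat, bsum_scale).

Fact tadd_assoc : associative tadd.
Proof. by move=> x y z; apply: tens_reprP => U f; rewrite !simp addrA. Qed.
Fact tadd_comm : commutative tadd.
Proof. by move=> x y; apply: tens_reprP => U f; rewrite !simp addrC. Qed.
Fact tadd_zero : left_id tzero tadd.
Proof.
by move=> x; apply: tens_reprP => U f; rewrite !simp /bsum big_nil add0r.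
Qed.
Fact tadd_opp : left_inverse tzero topp tadd.
Proof.
move=> x; apply: tens_reprP => U f.
by rewrite !simp scaleN1r addNr /bsum big_nil.
Qed.
HB.instance Definition _ :=
  GRing.isZmodule.Build tens tadd_assoc tadd_comm tadd_zero tadd_opp.

Fact tscale_assoc a b x : tscale a (tscale b x) = tscale (a * b) x.
Proof. by apply: tens_reprP => U f; rewrite !simp scalerA. Qed.
Fact tscale_1 : left_id 1 tscale.
Proof. by move=> x; apply: tens_reprP => U f; rewrite !simp scale1r. Qed.
Fact tscale_Dr : right_distributive tscale +%R.
Proof. by move=> a x y; apply: tens_reprP => U f; rewrite !simp scalerDr. Qed.
Fact tscale_Dl x : {morph tscale^~ x : a b / a + b}.
Proof. by move=> a b; apply: tens_reprP => U f; rewrite !simp scalerDl. Qed.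
HB.instance Definition _ := GRing.Zmodule_isLmodule.Build k tens
  tscale_assoc tscale_1 tscale_Dr tscale_Dl.

Definition pure (v : V) (w : W) : tens := \pi_tens [:: (v, w)].

Fact pure_bilinear : bilinear_for *:%R *:%R pure.
Proof.
by split=> [w a v v'|v a w w']; apply: tens_reprP => U f;
  rewrite !simp /bsum !big_seq1 /= ?linearPl ?linearPr.
Qed.
HB.instance Definition _ :=
  bilinear_isBilinear.Build k V W tens *:%R *:%R pure pure_bilinear.
HB.instance Definition _ (v : V) :=
  GRing.isLinear.Build k W tens *:%R (pure v) (pure_bilinear.2 v).

Lemma tens_sum (x : tens) : x = \sum_(p <- repr x) pure p.1 p.2.
Proof.
apply: tens_reprP => U f; elim: (repr x) => [|p s IHs].
  by rewrite big_nil !simp.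
by rewrite big_cons !simp -IHs /bsum big_cons big_seq1.
Qed.

Lemma tens_ind (P : tens -> Prop) :
  P 0 -> (forall v w, P (pure v w)) -> (forall x y, P x -> P y -> P (x + y)) ->
  forall x, P x.
Proof. by move=> P0 Pp PD x; rewrite (tens_sum x); apply: big_ind. Qed.

Section Lift.
Variables (U : lmodType k) (f : {bilinear V -> W -> U}).

Definition tlift_fun (x : tens) : U := bsum f (repr x).
Fact tlift_linear : linear tlift_fun.
Proof. by move=> a x y; rewrite /tlift_fun !simp. Qed.
HB.instance Definition _ :=
  GRing.isLinear.Build k tens U *:%R tlift_fun tlift_linear.
End Lift.

Lemma tens_ext (U : lmodType k) (f g : {linear tens -> U}) :
  (forall v w, f (pure v w) = g (pure v w)) -> f =1 g.
Proof.
move=> fg; elim/tens_ind => [|//|x y hx hy]; first by rewrite !linear0.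
by rewrite !linearD hx hy.
Qed.

End Tensor.

HB.lock Definition tlift (k : fieldType) (V W U : lmodType k)
  (f : {bilinear V -> W -> U}) : {linear tens V W -> U} := tlift_fun f.

Lemma tliftE (k : fieldType) (V W U : lmodType k)
  (f : {bilinear V -> W -> U}) v w : tlift f (pure v w) = f v w.
Proof.
by rewrite tlift.unlock /= /tlift_fun bsum_repr /bsum big_seq1.
Qed.

Notation "V ⊗ W" := (tens V W) (at level 40, left associativity) : type_scope.
Notation "v ⊠ w" := (pure v w) (at level 40, left associativity) : ring_scope.

(** ** Maps between tensor products *)
Section TensorMaps.
Variable k : fieldType.

Section Tmap.
Variables (V V' W W' : lmodType k).
Variables (f : {linear V -> V'}) (g : {linear W -> W'}).

Definition tmap_fun (v : V) (w : W) : V' ⊗ W' := f v ⊠ g w.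
Fact tmap_bilinear : bilinear_for *:%R *:%R tmap_fun.
Proof.
by split=> [w a v v'|v a w w']; rewrite /tmap_fun linearP ?linearPl ?linearPr.
Qed.
HB.instance Definition _ :=
  bilinear_isBilinear.Build k V W (V' ⊗ W') *:%R *:%R tmap_fun tmap_bilinear.
End Tmap.
End TensorMaps.

HB.lock Definition tmap (k : fieldType) (V V' W W' : lmodType k)
    (f : {linear V -> V'}) (g : {linear W -> W'}) :
    {linear V ⊗ W -> V' ⊗ W'} := tlift (tmap_fun f g).
Notation "f <⊗> g" := (tmap f g) (at level 40, left associativity) : ring_scope.

Lemma tmapE (k : fieldType) (V V' W W' : lmodType k) (f : {linear V -> V'})
  (g : {linear W -> W'}) v w : (f <⊗> g) (v ⊠ w) = f v ⊠ g w.
Proof. by rewrite tmap.unlock tliftE. Qed.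

Section Assoc.
Variables (k : fieldType) (U V W : lmodType k).

Definition tassoc_fun (t : U ⊗ V) (w : W) : U ⊗ (V ⊗ W) :=
  tmap idfun (applyr (@pure k V W) w) t.
Fact tassoc_bilinear : bilinear_for *:%R *:%R tassoc_fun.
Proof.
split=> [w a t t'|t a w w']; rewrite /tassoc_fun; first by rewrite linearP.
elim/tens_ind: t => [|u v|t t' ht ht']; first by rewrite !linear0 /= scaler0 addr0.
  by rewrite !tmapE /= !linearPr.
by rewrite !linearD ht ht' /= scalerDr addrACA.
Qed.
HB.instance Definition _ := bilinear_isBilinear.Build k (U ⊗ V) W
  (U ⊗ (V ⊗ W)) *:%R *:%R tassoc_fun tassoc_bilinear.

Definition tassocV_fun (u : U) (t : V ⊗ W) : U ⊗ V ⊗ W :=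
  tmap (@pure k U V u) idfun t.
Fact tassocV_bilinear : bilinear_for *:%R *:%R tassocV_fun.
Proof.
split=> [t a u u'|u a t t']; rewrite /tassocV_fun; last by rewrite linearP.
elim/tens_ind: t => [|v w|t t' ht ht']; first by rewrite !linear0 /= scaler0 addr0.
  by rewrite !tmapE /= !linearPl.
by rewrite !linearD ht ht' /= scalerDr addrACA.
Qed.
HB.instance Definition _ := bilinear_isBilinear.Build k U (V ⊗ W)
  (U ⊗ V ⊗ W) *:%R *:%R tassocV_fun tassocV_bilinear.
End Assoc.

HB.lock Definition tassoc (k : fieldType) (U V W : lmodType k) :
  {linear U ⊗ V ⊗ W -> U ⊗ (V ⊗ W)} := tlift (@tassoc_fun k U V W).
HB.lock Definition tassocV (k : fieldType) (U V W : lmodType k) :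
  {linear U ⊗ (V ⊗ W) -> U ⊗ V ⊗ W} := tlift (@tassocV_fun k U V W).

Lemma tassocE (k : fieldType) (U V W : lmodType k) (u : U) (v : V) (w : W) :
  tassoc U V W (u ⊠ v ⊠ w) = u ⊠ (v ⊠ w).
Proof. by rewrite tassoc.unlock tliftE /= /tassoc_fun tmapE. Qed.
Lemma tassocVE (k : fieldType) (U V W : lmodType k) (u : U) (v : V) (w : W) :
  tassocV U V W (u ⊠ (v ⊠ w)) = u ⊠ v ⊠ w.
Proof. by rewrite tassocV.unlock tliftE /= /tassocV_fun tmapE. Qed.

(** * Super and N-graded vector spaces

    A decomposition into homogeneous parts is given by its projections. *)

HB.mixin Record isSuper (k : fieldType) V of GRing.Lmodule k V := {
  par : bool -> {linear V -> V};
  par_par : forall b c v, par b (par c v) = if b == c then par c v else 0;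
  par_sum : forall v, \sum_(b : bool) par b v = v
}.
#[short(type="superType")]
HB.structure Definition Super (k : fieldType) :=
  {V of GRing.Lmodule k V & isSuper k V}.

HB.mixin Record isNGraded (k : fieldType) V of Super k V := {
  grd : nat -> {linear V -> V};
  grd_grd : forall m n v, grd m (grd n v) = if m == n then grd n v else 0;
  grd_sum : forall v, exists N, \sum_(n < N) grd n v = v;
  par_grd : forall b n v, par b (grd n v) = if b == odd n then grd n v else 0
}.
#[short(type="gradedType")]
HB.structure Definition NGraded (k : fieldType) :=
  {V of Super k V & isNGraded k V}.

Section SuperTensor.
Variable k : fieldType.

Section Par.
Variables V W : superType k.

Definition tpar_fun (b : bool) (t : V ⊗ W) : V ⊗ W :=
  \sum_(c : bool) (par c <⊗> par (b (+) c)) t.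
Fact tpar_linear b : linear (tpar_fun b).
Proof.
move=> a x y; rewrite /tpar_fun scaler_sumr -big_split /=.
by apply: eq_bigr => c _; rewrite linearP.
Qed.
HB.instance Definition _ b :=
  GRing.isLinear.Build k (V ⊗ W) (V ⊗ W) *:%R (tpar_fun b) (tpar_linear b).

Fact tpar_par b c t :
  tpar_fun b (tpar_fun c t) = if b == c then tpar_fun c t else 0.
Proof.
elim/tens_ind: t => [|v w|x y hx hy]; first by rewrite !linear0 if_same.
  rewrite /tpar_fun !big_bool !linearD /= !tmapE !par_par.
  by case: b; case: c; rewrite /= ?linear0l ?linear0r ?addr0 ?add0r.
by rewrite !linearD /= hx hy; case: ifP; rewrite ?addr0.
Qed.

Fact tpar_sum t : \sum_(b : bool) tpar_fun b t = t.
Proof.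
elim/tens_ind: t => [|v w|x y hx hy].
- by rewrite big1 // => b _; rewrite linear0.
- rewrite -{2}[v]par_sum -{2}[w]par_sum !big_bool /tpar_fun !big_bool /= !tmapE.
  rewrite !linearDl !linearDr /= addrC addrACA; congr (_ + _).
  exact: addrC.
- rewrite -{2}hx -{2}hy -big_split; apply: eq_bigr => b _.
  by rewrite linearD.
Qed.

HB.instance Definition _ := isSuper.Build k (V ⊗ W) tpar_par tpar_sum.
End Par.

Section Grd.
Variables V W : gradedType k.

Definition tgrd_fun (n : nat) (t : V ⊗ W) : V ⊗ W :=
  \sum_(i < n.+1) (grd i <⊗> grd (n - i)%N) t.
Fact tgrd_linear n : linear (tgrd_fun n).
Proof.
move=> a x y; rewrite /tgrd_fun scaler_sumr -big_split /=.
by apply: eq_bigr => c _; rewrite linearP.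
Qed.
HB.instance Definition _ n :=
  GRing.isLinear.Build k (V ⊗ W) (V ⊗ W) *:%R (tgrd_fun n) (tgrd_linear n).

Lemma tgrd_pure n i j v w :
  tgrd_fun n (grd i v ⊠ grd j w) =
  if n == (i + j)%N then grd i v ⊠ grd j w else 0.
Proof.
rewrite /tgrd_fun; under eq_bigr do rewrite tmapE !grd_grd.
have [->|nij] := eqVneq n (i + j)%N.
  have li : (i < (i + j).+1)%N by rewrite ltnS leq_addr.
  rewrite (bigD1 (Ordinal li)) //= eqxx addKn eqxx big1 ?addr0 // => l.
  by rewrite -val_eqE /= => /negPf ->; rewrite linear0l.
rewrite big1 // => l _; case: eqP => [li|_]; last by rewrite linear0l.
case: eqP => [lj|_]; last by rewrite linear0.
by case/eqP: nij; rewrite -li -lj subnKC // -ltnS.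
Qed.

Lemma tens_grd_ind (P : V ⊗ W -> Prop) :
  P 0 -> (forall i j v w, P (grd i v ⊠ grd j w)) ->
  (forall x y, P x -> P y -> P (x + y)) -> forall t, P t.
Proof.
move=> P0 Pp PD; elim/tens_ind => // v w.
have [N <-] := grd_sum v; have [M <-] := grd_sum w.
rewrite linear_sumlz; apply: big_ind => // i _.
by rewrite linear_sum; apply: big_ind => // j _; apply: Pp.
Qed.

Fact tgrd_grd m n t :
  tgrd_fun m (tgrd_fun n t) = if m == n then tgrd_fun n t else 0.
Proof.
elim/tens_grd_ind: t => [|i j v w|x y hx hy]; first by rewrite !linear0 if_same.
  rewrite tgrd_pure; case: (eqVneq n) => [->|_]; first exact: tgrd_pure.
  by rewrite linear0 if_same.
by rewrite !linearD /= hx hy; case: ifP; rewrite ?addr0.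
Qed.

Fact tgrd_sum t : exists N, \sum_(n < N) tgrd_fun n t = t.
Proof.
suff [N hN] : exists N, forall K, (N <= K)%N -> \sum_(n < K) tgrd_fun n t = t.
  by exists N; apply: hN.
elim/tens_grd_ind: t => [|i j v w|x y [N hN] [M hM]].
- by exists 0%N => K _; rewrite big1 // => n _; rewrite linear0.
- exists (i + j).+1 => K ltK; rewrite (bigD1 (Ordinal ltK)) //=.
  rewrite tgrd_pure eqxx big1 ?addr0 // => n.
  by rewrite -val_eqE tgrd_pure /= => /negPf ->.
- exists (maxn N M) => K; rewrite geq_max => /andP[leN leM].
  rewrite -{2}(hN K) // -{2}(hM K) // -big_split.
  by apply: eq_bigr => n _; rewrite linearD.
Qed.

Fact tpar_grd b n t :
  par b (tgrd_fun n t) = if b == odd n then tgrd_fun n t else 0.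
Proof.
elim/tens_grd_ind: t => [|i j v w|x y hx hy]; first by rewrite !linear0 if_same.
  rewrite tgrd_pure; case: eqP => [->|_]; last by rewrite linear0 if_same.
  rewrite /par /= /tpar_fun big_bool /= !tmapE !par_grd oddD.
  by case: b; case: (odd i); case: (odd j);
    rewrite /= ?linear0l ?linear0 ?addr0 ?add0r.
by rewrite !linearD /= hx hy; case: ifP; rewrite ?addr0.
Qed.

HB.instance Definition _ :=
  isNGraded.Build k (V ⊗ W) tgrd_grd tgrd_sum tpar_grd.
End Grd.

End SuperTensor.

HB.lock Definition lcomp (k : fieldType) (U V W : lmodType k)
  (g : {linear V -> W}) (f : {linear U -> V}) : {linear U -> W} := g \o f.

Lemma lcompE (k : fieldType) (U V W : lmodType k) (g : {linear V -> W})
  (f : {linear U -> V}) (u : U) : lcomp g f u = g (f u).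
Proof. by rewrite lcomp.unlock. Qed.

HB.lock Definition idl (k : fieldType) (V : lmodType k) : {linear V -> V} :=
  idfun.

Lemma idlE (k : fieldType) (V : lmodType k) (v : V) : idl V v = v.
Proof. by rewrite idl.unlock. Qed.

Arguments idl {k V}.
Notation "g ∘ f" := (lcomp g f) (at level 50, left associativity) : ring_scope.

Section LinearMaps.
Variable k : fieldType.

(** (f (x) id) and (id (x) f) for a linear form f, followed by the
    identifications of k (x) W with W and of V (x) k with V. *)
Section Contraction.
Variables V W : lmodType k.

Definition contractl_fun (f : {scalar V}) (v : V) (w : W) : W := f v *: w.
Fact contractl_bilinear f : bilinear_for *:%R *:%R (contractl_fun f).
Proof.
split=> [w a v v'|v a w w'] /=; rewrite /contractl_fun.
  by rewrite linearP scalerDl scalerA.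
by rewrite scalerDr !scalerA mulrC.
Qed.
HB.instance Definition _ f := bilinear_isBilinear.Build k V W W *:%R *:%R
  (contractl_fun f) (contractl_bilinear f).

Definition contractr_fun (f : {scalar W}) (v : V) (w : W) : V := f w *: v.
Fact contractr_bilinear f : bilinear_for *:%R *:%R (contractr_fun f).
Proof.
split=> [w a v v'|v a w w'] /=; rewrite /contractr_fun.
  by rewrite scalerDr !scalerA mulrC.
by rewrite linearP scalerDl scalerA.
Qed.
HB.instance Definition _ f := bilinear_isBilinear.Build k V W V *:%R *:%R
  (contractr_fun f) (contractr_bilinear f).
End Contraction.

End LinearMaps.

HB.lock Definition contractl (k : fieldType) (V W : lmodType k)
  (f : {scalar V}) : {linear V ⊗ W -> W} := tlift (@contractl_fun k V W f).
HB.lock Definition contractr (k : fieldType) (V W : lmodType k)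
  (f : {scalar W}) : {linear V ⊗ W -> V} := tlift (@contractr_fun k V W f).

Lemma contractlE (k : fieldType) (V W : lmodType k) (f : {scalar V})
  (v : V) (w : W) : contractl W f (v ⊠ w) = f v *: w.
Proof. by rewrite contractl.unlock tliftE. Qed.
Lemma contractrE (k : fieldType) (V W : lmodType k) (f : {scalar W})
  (v : V) (w : W) : contractr V f (v ⊠ w) = f w *: v.
Proof. by rewrite contractr.unlock tliftE. Qed.

(** ** Koszul sign rule *)
Section Koszul.
Variable k : fieldType.

Section Swap.
Variables V W : superType k.

(** v (x) w |-> (-1)^(|v||w|) w (x) v on homogeneous elements *)
Definition sswap_fun (v : V) (w : W) : W ⊗ V :=
  \sum_(b : bool) \sum_(c : bool) (-1) ^+ (b && c) *: (par c w ⊠ par b v).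
Fact sswap_bilinear : bilinear_for *:%R *:%R sswap_fun.
Proof.
split=> [w a v v'|v a w w'] /=; rewrite /sswap_fun scaler_sumr -big_split;
  apply: eq_bigr => b _; rewrite /= scaler_sumr -big_split;
  apply: eq_bigr => c _; rewrite /= linearP ?linearPl ?linearPr /=;
  by rewrite scalerDr !scalerA mulrC.
Qed.
HB.instance Definition _ := bilinear_isBilinear.Build k V W (W ⊗ V)
  *:%R *:%R sswap_fun sswap_bilinear.
End Swap.
End Koszul.

HB.lock Definition sswap (k : fieldType) (V W : superType k) :
  {linear V ⊗ W -> W ⊗ V} := tlift (@sswap_fun k V W).

Lemma sswapE (k : fieldType) (V W : superType k) b c (v : V) (w : W) :
  sswap V W (par b v ⊠ par c w) = (-1) ^+ (b && c) *: (par c w ⊠ par b v).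
Proof.
rewrite sswap.unlock tliftE /= /sswap_fun !big_bool !par_par /=.
by case: b; case: c; rewrite /= ?linear0l ?linear0 ?scaler0 ?addr0 ?add0r.
Qed.

(** u (x) (v (x) w) |-> f (u (x) v) (x) w, reassociated *)
HB.lock Definition on12 (k : fieldType) (U V U' V' W : lmodType k)
    (f : {linear U ⊗ V -> V' ⊗ U'}) :
    {linear U ⊗ (V ⊗ W) -> V' ⊗ (U' ⊗ W)} :=
  tassoc V' U' W ∘ (f <⊗> idl) ∘ tassocV U V W.

(** (u (x) v) (x) (w (x) x) |-> u (x) f (v (x) w) (x) x, reassociated *)
HB.lock Definition on23 (k : fieldType) (U V W V' W' X : lmodType k)
    (f : {linear V ⊗ W -> W' ⊗ V'}) :
    {linear U ⊗ V ⊗ (W ⊗ X) -> U ⊗ W' ⊗ (V' ⊗ X)} :=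
  tassocV U W' (V' ⊗ X) ∘ (idl <⊗> on12 X f) ∘ tassoc U V (W ⊗ X).

Lemma on12E (k : fieldType) (U V U' V' W : lmodType k)
    (f : {linear U ⊗ V -> V' ⊗ U'}) (u : U) (v : V) (w : W) :
  on12 W f (u ⊠ (v ⊠ w)) = tassoc V' U' W (f (u ⊠ v) ⊠ w).
Proof. by rewrite on12.unlock !lcompE tassocVE tmapE idlE. Qed.

Lemma on23E (k : fieldType) (U V W V' W' X : lmodType k)
    (f : {linear V ⊗ W -> W' ⊗ V'}) (u : U) (v : V) (w : W) (x : X) :
  on23 U X f (u ⊠ v ⊠ (w ⊠ x)) =
  tassocV U W' (V' ⊗ X) (u ⊠ tassoc W' V' X (f (v ⊠ w) ⊠ x)).
Proof. by rewrite on23.unlock !lcompE tassocE tmapE idlE on12E. Qed.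

Section Signs.
Variable k : fieldType.

(** v |-> (-1)^|v| v on homogeneous elements *)
Definition sgn (V : superType k) : {linear V -> V} := par false \- par true.

(** u (x) (v (x) w) |-> (-1)^(|u||v|) v (x) (u (x) w) *)
Definition swap12 (U V W : superType k) :
    {linear U ⊗ (V ⊗ W) -> V ⊗ (U ⊗ W)} := on12 W (sswap U V).

(** (u (x) v) (x) (w (x) x) |-> (-1)^(|v||w|) (u (x) w) (x) (v (x) x) *)
Definition swap23 (U V W X : superType k) :
    {linear U ⊗ V ⊗ (W ⊗ X) -> U ⊗ W ⊗ (V ⊗ X)} := on23 U X (sswap V W).

Lemma swap12E (U V W : superType k) b c (u : U) (v : V) (w : W) :
  swap12 U V W (par b u ⊠ (par c v ⊠ w)) =
  (-1) ^+ (b && c) *: (par c v ⊠ (par b u ⊠ w)).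
Proof. by rewrite /swap12 on12E sswapE linearZl_LR /= linearZ /= tassocE. Qed.

Lemma swap23E (U V W X : superType k) b c (u : U) (v : V) (w : W) (x : X) :
  swap23 U V W X (u ⊠ par b v ⊠ (par c w ⊠ x)) =
  (-1) ^+ (b && c) *: (u ⊠ par c w ⊠ (par b v ⊠ x)).
Proof.
rewrite /swap23 on23E sswapE linearZl_LR /= linearZ /= tassocE.
by rewrite !linearZ /= tassocVE.
Qed.

Definition even_map (V W : superType k) (f : V -> W) : Prop :=
  forall b v, f (par b v) = par b (f v).

Definition degree_preserving (V W : gradedType k) (f : V -> W) : Prop :=
  forall n v, f (grd n v) = grd n (f v).

Definition concentrated_in_degree_0 (V : superType k) : Prop :=
  forall v : V, par true v = 0.

(** d (x) id + (-1)^| | id (x) d *)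
Definition tdiff (V W : superType k) (dV : {linear V -> V})
    (dW : {linear W -> W}) : {linear V ⊗ W -> V ⊗ W} :=
  (dV <⊗> idl) \+ (sgn V <⊗> dW).

End Signs.

Arguments sgn {k V}.

(** * Super Hopf algebras

    Structures are given by their structure maps on a super vector space, since
    the same space (e.g. a tensor product) carries several of them.  An ordinary
    algebra, Hopf algebra etc. is one whose underlying super vector space is
    concentrated in degree 0. *)
Section Hopf.
Variable k : fieldType.

Record algebra (V : superType k) := Algebra {
  amul : {linear V ⊗ V -> V};
  aone : V }.

Record coalgebra (V : superType k) := Coalgebra {
  comul : {linear V -> V ⊗ V};
  counit : {scalar V} }.

Record hopf_data (V : superType k) := HopfData {
  hopf_alg :> algebra V;
  hopf_coalg :> coalgebra V;
  antipode : {linear V -> V} }.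

Record is_algebra (V : superType k) (m : algebra V) : Prop := {
  mul_assoc : forall x y z,
    amul m (amul m (x ⊠ y) ⊠ z) = amul m (x ⊠ amul m (y ⊠ z));
  mul_1l : forall x, amul m (aone m ⊠ x) = x;
  mul_1r : forall x, amul m (x ⊠ aone m) = x;
  mul_even : even_map (amul m);
  one_even : par false (aone m) = aone m }.

Record is_coalgebra (V : superType k) (c : coalgebra V) : Prop := {
  comul_assoc : forall x,
    tassoc V V V ((comul c <⊗> idl) (comul c x)) =
    (idl <⊗> comul c) (comul c x);
  comul_counitl : forall x, contractl V (counit c) (comul c x) = x;
  comul_counitr : forall x, contractr V (counit c) (comul c x) = x;
  comul_even : even_map (comul c);
  counit_even : forall x, counit c (par true x) = 0 }.

(** Super tensor product of algebras:
    (a (x) b)(c (x) d) = (-1)^(|b||c|) ac (x) bd *)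
Definition tens_alg (V W : superType k) (m : algebra V) (n : algebra W) :
    algebra (V ⊗ W) :=
  Algebra ((amul m <⊗> amul n) ∘ swap23 V W V W) (aone m ⊠ aone n).

Definition alg_hom (V W : superType k) (m : algebra V) (n : algebra W)
    (f : V -> W) : Prop :=
  (forall x y, f (amul m (x ⊠ y)) = amul n (f x ⊠ f y)) /\ f (aone m) = aone n.

Definition counit_alg_hom (V : superType k) (H : hopf_data V) : Prop :=
  (forall x y, counit H (amul H (x ⊠ y)) = counit H x * counit H y) /\
  counit H (aone H) = 1.

Definition antipode_axiom (V : superType k) (H : hopf_data V) : Prop :=
  (forall x, amul H ((antipode H <⊗> idl) (comul H x)) = counit H x *: aone H) /\
  (forall x, amul H ((idl <⊗> antipode H) (comul H x)) = counit H x *: aone H).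

Record super_hopf (V : superType k) (H : hopf_data V) : Prop := {
  sh_alg : is_algebra H;
  sh_coalg : is_coalgebra H;
  sh_comul : alg_hom H (tens_alg H H) (comul H);
  sh_counit : counit_alg_hom H;
  sh_antipode_even : even_map (antipode H);
  sh_antipode : antipode_axiom H }.

Record hopf_algebra (V : superType k) (H : hopf_data V) : Prop := {
  ha_super : super_hopf H;
  ha_degree0 : concentrated_in_degree_0 V;
  ha_antipode_bij : bijective (antipode H) }.

End Hopf.

(** * Super right crossed modules and braided Hopf algebras *)
Section Crossed.
Variable k : fieldType.

Record crossed_data (K V : superType k) := CrossedData {
  act : {linear V ⊗ K -> V};
  coact : {linear V -> V ⊗ K} }.

Record right_module (K V : superType k) (m : algebra K)
    (r : {linear V ⊗ K -> V}) : Prop := {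
  act_mul : forall v a b, r (r (v ⊠ a) ⊠ b) = r (v ⊠ amul m (a ⊠ b));
  act_one : forall v, r (v ⊠ aone m) = v;
  act_even : even_map r }.

Record right_comodule (K V : superType k) (c : coalgebra K)
    (r : {linear V -> V ⊗ K}) : Prop := {
  coact_comul : forall v,
    tassoc V K K ((r <⊗> idl) (r v)) = (idl <⊗> comul c) (r v);
  coact_counit : forall v, contractr V (counit c) (r v) = v;
  coact_even : even_map r }.

Section Fixed.
Variables (K : superType k) (H : hopf_data K).

(** (v0 (x) v1) (x) (a1 (x) (a2 (x) a3)) |->
    (-1)^(|v1|(|a1|+|a2|)+|a1||a2|) v0 <| a2 (x) (S a1) v1 a3:
    exchange a1 and a2, then v1 and a2, then v1 and a1. *)
Definition crossed_rhs (V : superType k) (x : crossed_data K V) :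
    {linear V ⊗ K ⊗ (K ⊗ (K ⊗ K)) -> V ⊗ K} :=
  (act x <⊗> (amul H ∘ (antipode H <⊗> amul H) ∘ swap12 K K K))
  ∘ swap23 V K K (K ⊗ K)
  ∘ (idl <⊗> swap12 K K K).

Record crossed_module (V : superType k) (x : crossed_data K V) : Prop := {
  cm_module : right_module H (act x);
  cm_comodule : right_comodule H (coact x);
  cm_compat : forall v a,
    coact x (act x (v ⊠ a)) =
    crossed_rhs x (coact x v ⊠ (idl <⊗> comul H) (comul H a)) }.

(** Tensor product of crossed modules:
    (v (x) w) <| a = (-1)^(|w||a1|) v <| a1 (x) w <| a2 and
    v (x) w |-> (-1)^(|v1||w0|) v0 (x) w0 (x) v1 w1. *)
Definition tens_crossed (V W : superType k) (x : crossed_data K V)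
    (y : crossed_data K W) : crossed_data K (V ⊗ W) :=
  CrossedData
    ((act x <⊗> act y) ∘ swap23 V W K K ∘ (idl <⊗> comul H))
    ((idl <⊗> amul H) ∘ swap23 V K W K ∘ (coact x <⊗> coact y)).

Record crossed_morphism (V W : superType k) (x : crossed_data K V)
    (y : crossed_data K W) (f : {linear V -> W}) : Prop := {
  cmor_even : even_map f;
  cmor_act : forall v a, f (act x (v ⊠ a)) = act y (f v ⊠ a);
  cmor_coact : forall v, coact y (f v) = (f <⊗> idl) (coact x v) }.

(** v (x) w |-> (-1)^(|v||w0|) w0 (x) (v <| w1) *)
Definition braiding (V W : superType k) (x : crossed_data K V)
    (y : crossed_data K W) : {linear V ⊗ W -> W ⊗ V} :=
  (idl <⊗> act x) ∘ swap12 V W K ∘ (idl <⊗> coact y).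

Definition module_algebra (V : superType k) (m : algebra V)
    (x : crossed_data K V) : Prop :=
  (forall v w a, act x (amul m (v ⊠ w) ⊠ a) =
     amul m (act (tens_crossed x x) ((v ⊠ w) ⊠ a))) /\
  (forall a, act x (aone m ⊠ a) = counit H a *: aone m).

Definition comodule_algebra (V : superType k) (m : algebra V)
    (r : {linear V -> V ⊗ K}) : Prop := alg_hom m (tens_alg m H) r.

Record crossed_algebra (V : superType k) (m : algebra V)
    (x : crossed_data K V) : Prop := {
  ca_crossed : crossed_module x;
  ca_alg : is_algebra m;
  ca_module_alg : module_algebra m x;
  ca_comodule_alg : comodule_algebra m (coact x) }.

(** (b (x) b')(c (x) c') = b Psi(b' (x) c) c' *)
Definition braided_tens_alg (B : superType k) (m : algebra B)
    (x : crossed_data K B) : algebra (B ⊗ B) :=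
  Algebra ((amul m <⊗> amul m) ∘ on23 B B (braiding x x)) (aone m ⊠ aone m).

Record braided_hopf (B : superType k) (HB : hopf_data B)
    (x : crossed_data K B) : Prop := {
  bh_crossed_alg : crossed_algebra HB x;
  bh_coalg : is_coalgebra HB;
  bh_comul_mor : crossed_morphism x (tens_crossed x x) (comul HB);
  bh_counit_act : forall b a,
    counit HB (act x (b ⊠ a)) = counit HB b * counit H a;
  bh_counit_coact : forall b,
    contractl K (counit HB) (coact x b) = counit HB b *: aone H;
  bh_antipode_mor : crossed_morphism x x (antipode HB);
  bh_comul : alg_hom HB (braided_tens_alg HB x) (comul HB);
  bh_counit : counit_alg_hom HB;
  bh_antipode : antipode_axiom HB }.

(** ** Biproduct / super bosonisation *)
Section Biproduct.
Variables (B : superType k) (HB : hopf_data B) (x : crossed_data K B).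

(** (a (x) b)(c (x) d) = (-1)^(|b||c1|) a c1 (x) (b <| c2) d *)
Definition biproduct_alg : algebra (K ⊗ B) :=
  Algebra
    ((amul H <⊗> (amul HB ∘ (act x <⊗> idl) ∘ tassocV B K B))
     ∘ swap23 K B K (K ⊗ B)
     ∘ (idl <⊗> (tassoc K K B ∘ (comul H <⊗> idl))))
    (aone H ⊠ aone HB).

(** b |-> b1^0 (x) (b1^1 (x) b2) *)
Definition canonical_coaction : {linear B -> B ⊗ (K ⊗ B)} :=
  tassoc B K B ∘ (coact x <⊗> idl) ∘ comul HB.

(** a (x) b |-> (-1)^(|a2||b1^0|) a1 (x) b1^0 (x) a2 b1^1 (x) b2 *)
Definition biproduct_coalg : coalgebra (K ⊗ B) :=
  Coalgebra
    ((idl <⊗> ((amul H <⊗> idl) ∘ tassocV K K B))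
     ∘ swap23 K K B (K ⊗ B)
     ∘ (comul H <⊗> canonical_coaction))
    (counit HB \o contractl B (counit H)).

End Biproduct.
End Fixed.
End Crossed.

(** * Exterior algebras *)
Section Exterior.
Variable k : fieldType.

(** [diff] is the differential of [O] and [incl] identifies [A] with the
    degree 0 part of [O]. *)
Record ext_data (A : superType k) (O : gradedType k) := ExtData {
  diff : {linear O -> O};
  incl : {linear A -> O} }.

Record exterior_algebra (A : superType k) (O : gradedType k)
    (mA : algebra A) (mO : algebra O) (e : ext_data A O) : Prop := {
  ext_alg : is_algebra mO;
  ext_mul_degree : degree_preserving (amul mO);
  ext_incl_hom : alg_hom mA mO (incl e);
  ext_incl_inj : injective (incl e);
  ext_degree0 : forall w, grd 0 w = w <-> exists a, w = incl e a;
  ext_diff_degree : forall n w, diff e (grd n w) = grd n.+1 (diff e w);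
  ext_diff_diff : forall w, diff e (diff e w) = 0;
  ext_leibniz : forall w t, diff e (amul mO (w ⊠ t)) =
    amul mO (diff e w ⊠ t) + amul mO (sgn w ⊠ diff e t);
  ext_degree1 : forall w, grd 1 w = w -> exists s : seq (A * A),
    w = \sum_(p <- s) amul mO (incl e p.1 ⊠ diff e (incl e p.2));
  ext_generated : forall P : O -> Prop,
    (forall c w t, P w -> P t -> P (c *: w + t)) ->
    (forall w t, P w -> P t -> P (amul mO (w ⊠ t))) ->
    (forall a, P (incl e a)) ->
    (forall w, grd 1 w = w -> P w) ->
    forall w, P w }.

(** [D] is a total-degree-preserving DGA map to the super tensor product that
    extends the coaction [r]. *)
Record differential_extension (B K : superType k) (OB OK : gradedType k)
    (mOB : algebra OB) (eB : ext_data B OB)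
    (mOK : algebra OK) (eK : ext_data K OK)
    (r : {linear B -> B ⊗ K}) (D : {linear OB -> OB ⊗ OK}) : Prop := {
  de_extends : forall b, D (incl eB b) = (incl eB <⊗> incl eK) (r b);
  de_degree : degree_preserving D;
  de_hom : alg_hom mOB (tens_alg mOB mOK) D;
  de_diff : forall w, D (diff eB w) = tdiff (diff eB) (diff eK) (D w) }.

Definition differentiable (B K : superType k) (OB OK : gradedType k)
    (mB : algebra B) (mOB : algebra OB) (eB : ext_data B OB)
    (mK : algebra K) (cK : coalgebra K) (mOK : algebra OK) (eK : ext_data K OK)
    (r : {linear B -> B ⊗ K}) : Prop :=
  [/\ right_comodule cK r, alg_hom mB (tens_alg mB mK) r &
      exists D, differential_extension mOB eB mOK eK r D].

Record strongly_bicovariant (A : superType k) (OA : gradedType k)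
    (HA : hopf_data A) (HOA : hopf_data OA) (e : ext_data A OA) : Prop := {
  sb_ext : exterior_algebra HA HOA e;
  sb_hopf : super_hopf HOA;
  sb_comul_degree : degree_preserving (comul HOA);
  sb_comul_extends : forall a,
    comul HOA (incl e a) = (incl e <⊗> incl e) (comul HA a);
  sb_comul_diff : forall w,
    comul HOA (diff e w) = tdiff (diff e) (diff e) (comul HOA w) }.

(** [xB] and [xOB] are the crossed module structures of [B] over [A] and of
    [OB] over [OA]. In [bsb_A_crossed] the action of [A] on [OB] is the
    restriction of that of [OA], and its coaction [r] is the component
    OB (x) A of the extended coaction OB -> OB (x) OA. *)
Record braided_strongly_bicovariant (A B : superType k) (OA OB : gradedType k)
    (HA : hopf_data A) (HOA : hopf_data OA) (eA : ext_data A OA)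
    (HB : hopf_data B) (xB : crossed_data A B)
    (HOB : hopf_data OB) (xOB : crossed_data OA OB) (eB : ext_data B OB) :
    Prop := {
  bsb_ext : exterior_algebra HB HOB eB;
  bsb_coact : differential_extension HOB eB HOA eA (coact xB) (coact xOB);
  bsb_A_crossed : exists r : {linear OB -> OB ⊗ A},
    (forall w, (idl <⊗> incl eA) (r w) = (idl <⊗> grd 0) (coact xOB w)) /\
    crossed_algebra HA HOB (CrossedData (act xOB ∘ (idl <⊗> incl eA)) r);
  bsb_act_extends : forall b a,
    incl eB (act xB (b ⊠ a)) = act xOB (incl eB b ⊠ incl eA a);
  bsb_act_degree : degree_preserving (act xOB);
  bsb_act_diff : forall w t, diff eB (act xOB (w ⊠ t)) =
    act xOB (diff eB w ⊠ t) + act xOB (sgn w ⊠ diff eA t);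
  bsb_B_braided : concentrated_in_degree_0 B /\ braided_hopf HA HB xB;
  bsb_comul_extends : forall b,
    comul HOB (incl eB b) = (incl eB <⊗> incl eB) (comul HB b);
  bsb_comul_degree : degree_preserving (comul HOB);
  bsb_braided : braided_hopf HOA HOB xOB;
  bsb_comul_diff : forall w,
    comul HOB (diff eB w) = tdiff (diff eB) (diff eB) (comul HOB w) }.

(** d(w (x) t) = d w (x) t + (-1)^|w| w (x) d t *)
Definition biproduct_ext (A B : superType k) (OA OB : gradedType k)
    (eA : ext_data A OA) (eB : ext_data B OB) :
    ext_data (A ⊗ B) (OA ⊗ OB) :=
  ExtData (tdiff (diff eA) (diff eB)) (incl eA <⊗> incl eB).

End Exterior.

(* Main.v *)
Require Import Defs.
From HB Require Import structures.
From mathcomp Require Import all_boot all_order all_algebra.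

Set Implicit Arguments.
Unset Strict Implicit.
Unset Printing Implicit Defensive.

Import GRing.Theory.
Local Open Scope ring_scope.

(** The canonical coaction sends b to b_1^0 (x) b_1^1 (x) b_2, a formula that
    makes sense verbatim for the super braided Hopf algebra Omega(B) over
    Omega(A).  The extension to forms is that same formula, so everything
    reduces to facts about super braided Hopf algebras in general, applied once
    to B over A and once to Omega(B) over Omega(A).

    Write the coaction as L after the braided coproduct, where
    L(b (x) c) = b^0 (x) b^1 (x) c.  The braided coproduct is multiplicative
    into the braided tensor square, and L is multiplicative from the braided
    tensor square to B (x) (K |>< B) ([coact_left_mul]): by the comodule algebra
    property both products of b (x) c and b' (x) c' become
       +/- b^0 b'^0 (x) b^1 b'^1 (x) (c <| b'^2) c',
    where b'^0 (x) b'^1 (x) b'^2 is the twofold coaction on b', iterated on one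
    side and obtained from the coproduct of K on the other.  Hence
    [canonical_coaction_hom].  That the formula is a coaction of the biproduct
    ([canonical_coaction_comodule]) follows in the same way from
    coassociativity of the braided coproduct and of the coaction, together with
    the fact that the braided coproduct is a comodule map.

    On forms, each of the three maps composed (braided coproduct, coaction,
    reassociation) preserves the total degree and intertwines the differentials
    of the tensor products, and each restricts in degree 0 to the corresponding
    map for B, which gives the remaining properties of a differentiable
    extension.

    Koszul signs are handled by reducing every tensor to sums of v (x) w with v
    and w of definite parity ([tens_homog_ind]); Sweedler sums are handled by
    stating each identity for an arbitrary tensor in place of the coaction or
    coproduct of an element. *)

(** * Parity and the sign rule *)
Section Homogeneous.
Variable k : fieldType.
Implicit Types U V W X : superType k.

Definition homog V (b : bool) (v : V) : Prop := par b v = v.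

Lemma homog_par V b (v : V) : homog b (par b v).
Proof. by rewrite /homog par_par eqxx. Qed.

Lemma par_homog V b c (v : V) : homog b v -> par c v = if c == b then v else 0.
Proof. by move=> hv; rewrite -[in LHS]hv par_par; case: ifP => //; rewrite hv. Qed.

Lemma even_homog V W (f : V -> W) b v : even_map f -> homog b v -> homog b (f v).
Proof. by move=> hf hv; rewrite /homog -hf hv. Qed.

Lemma homog_pure V W b c (v : V) (w : W) :
  homog b v -> homog c w -> homog (b (+) c) (v ⊠ w).
Proof.
move=> hv hw; rewrite /homog /par /= /tpar_fun big_bool /= !tmapE.
rewrite !(par_homog _ hv) !(par_homog _ hw).
by case: b hv; case: c hw; rewrite /= ?linear0l ?linear0 ?addr0 ?add0r.
Qed.

(** The induction principle under which all signs become explicit. *)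
Lemma tens_homog_ind V W (P : V ⊗ W -> Prop) :
  P 0 -> (forall x y, P x -> P y -> P (x + y)) ->
  (forall b c v w, homog b v -> homog c w -> P (v ⊠ w)) ->
  forall t, P t.
Proof.
move=> P0 PD Pp; elim/tens_ind => // v w.
rewrite -[v]par_sum -[w]par_sum !big_bool linearDl !linearDr /=.
by apply: (PD); apply: (PD); apply: Pp; apply: homog_par.
Qed.

Lemma swap12_homog U V W b c (u : U) (v : V) (w : W) :
  homog b u -> homog c v ->
  swap12 U V W (u ⊠ (v ⊠ w)) = (-1) ^+ (b && c) *: (v ⊠ (u ⊠ w)).
Proof. by move=> <- <-; rewrite swap12E. Qed.

Lemma swap23_homog U V W X b c (u : U) (v : V) (w : W) (x : X) :
  homog b v -> homog c w ->
  swap23 U V W X (u ⊠ v ⊠ (w ⊠ x)) = (-1) ^+ (b && c) *: (u ⊠ w ⊠ (v ⊠ x)).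
Proof. by move=> <- <-; rewrite swap23E. Qed.

Lemma sgn_homog V b (v : V) : homog b v -> sgn v = (-1) ^+ b *: v.
Proof.
move=> hv; rewrite /sgn /= !(par_homog _ hv).
by case: b hv => hv /=; rewrite ?sub0r ?subr0 ?scaleN1r ?scale1r.
Qed.

Lemma even_sgn V W (f : {linear V -> W}) v : even_map f -> f (sgn v) = sgn (f v).
Proof. by move=> hf; rewrite /sgn /= linearB !hf. Qed.

Lemma even_idl V : even_map (@idl k V).
Proof. by move=> b v; rewrite !idlE. Qed.

Lemma even_lcomp U V W (g : {linear V -> W}) (f : {linear U -> V}) :
  even_map g -> even_map f -> even_map (g ∘ f).
Proof. by move=> hg hf b v; rewrite !lcompE hf hg. Qed.

Lemma even_tmap V V' W W' (f : {linear V -> V'}) (g : {linear W -> W'}) :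
  even_map f -> even_map g -> even_map (f <⊗> g).
Proof.
move=> hf hg b; elim/tens_homog_ind => [|x y hx hy|c d v w hv hw].
- by rewrite !linear0.
- by rewrite !linearD hx hy.
- rewrite (par_homog _ (homog_pure hv hw)) tmapE.
  rewrite (par_homog _ (homog_pure (even_homog hf hv) (even_homog hg hw))).
  by case: ifP; rewrite ?tmapE ?linear0.
Qed.

Lemma even_tassoc U V W : even_map (tassoc U V W).
Proof.
move=> b; elim/tens_homog_ind => [|x y hx hy|c d t w ht hw].
- by rewrite !linear0.
- by rewrite !linearD hx hy.
rewrite -ht; elim/tens_homog_ind: t {ht} => [|x y hx hy|c' d' u v hu hv].
- by rewrite !(linear0, linear0l).
- by rewrite !(linearD, linearDl) hx hy.
rewrite (par_homog _ (homog_pure hu hv)); case: eqP => [_|]; last first.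
  by rewrite !(linear0, linear0l).
rewrite tassocE (par_homog _ (homog_pure (homog_pure hu hv) hw)).
rewrite (par_homog _ (homog_pure hu (homog_pure hv hw))) addbA.
by case: ifP; rewrite ?tassocE ?linear0.
Qed.

End Homogeneous.

(** * The canonical coaction is an algebra map *)

Lemma pureDl (k : fieldType) (V W : lmodType k) (v v' : V) (w : W) :
  (v + v') ⊠ w = v ⊠ w + v' ⊠ w.
Proof. exact: linearDl. Qed.

Lemma pureDr (k : fieldType) (V W : lmodType k) (v : V) (w w' : W) :
  v ⊠ (w + w') = v ⊠ w + v ⊠ w'.
Proof. exact: linearD. Qed.

Lemma tassocVK (k : fieldType) (U V W : lmodType k) :
  cancel (tassoc U V W) (tassocV U V W).
Proof.
move=> t; rewrite -lcompE -[RHS]idlE; move: t.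
apply: tens_ext => t w; rewrite lcompE idlE.
elim/tens_ind: t => [|u v|s t hs ht]; first by rewrite !(linear0, linear0l).
  by rewrite tassocE tassocVE.
by rewrite !(linearD, linearDl) /= hs ht.
Qed.

Lemma tens_alg_mulE (k : fieldType) (V W : superType k) (m : algebra V)
  (n : algebra W) s : amul (tens_alg m n) s =
  (amul m <⊗> amul n) (swap23 V W V W s).
Proof. by rewrite /= lcompE. Qed.

(** b (x) c |-> b^0 (x) (b^1 (x) c): what remains of the canonical coaction
    after the braided coproduct. *)
HB.lock Definition coact_left (k : fieldType) (K B : superType k)
  (x : crossed_data K B) : {linear B ⊗ B -> B ⊗ (K ⊗ B)} :=
  tassoc B K B ∘ (coact x <⊗> idl).

Section Biproduct.
Variables (k : fieldType) (K B : superType k).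
Variables (H : hopf_data K) (HB : hopf_data B) (x : crossed_data K B).
Hypothesis hB : braided_hopf H HB x.

Let hcross := ca_crossed (bh_crossed_alg hB).
Let hcomod := cm_comodule hcross.

Lemma canonical_coactionE b :
  canonical_coaction HB x b = coact_left x (comul HB b).
Proof. by rewrite /canonical_coaction coact_left.unlock !lcompE. Qed.

Lemma coact_left_pure b c : coact_left x (b ⊠ c) = tassoc B K B (coact x b ⊠ c).
Proof. by rewrite coact_left.unlock lcompE tmapE idlE. Qed.

Let mBK := amul (tens_alg HB H).
Let mbip := amul (biproduct_alg H HB x).

(** (s (x) a) |-> (-1)^(|c||s|) u s (x) (c <| a) c', the common form of the two
    products compared in [coact_left_mul].  It takes a threefold tensor, so that
    coassociativity of the coaction can be used on its argument; the swap of c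
    with s supplies the sign. *)
Definition mul_side (c c' : B) (u : B ⊗ K) :
    {linear (B ⊗ K) ⊗ K -> B ⊗ (K ⊗ B)} :=
  tassoc B K B
  ∘ ((mBK ∘ pure u) <⊗> (amul HB ∘ applyr (@pure k B B) c' ∘ act x))
  ∘ swap12 B (B ⊗ K) K ∘ pure c.

Lemma mul_sideE r i c c' u s y : homog r c -> homog i s ->
  mul_side c c' u (s ⊠ y) = (-1) ^+ (r && i) *:
     tassoc B K B (mBK (u ⊠ s) ⊠ amul HB (act x (c ⊠ y) ⊠ c')).
Proof.
move=> hc hs; rewrite /mul_side !lcompE (swap12_homog _ hc hs).
by rewrite !linearZ tmapE !lcompE.
Qed.

(** The argument u will be a coaction value, treated by induction on tensors. *)
Lemma mul_side_linear r c c' w : homog r c ->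
  linear (fun u => mul_side c c' u w).
Proof.
move=> hc a u v; elim/tens_homog_ind: w => [|s t hs ht|i j s y hs _].
- by rewrite !linear0 addr0.
- by rewrite !linearD hs ht addrACA.
rewrite !(mul_sideE _ _ _ hc hs) linearPl linearP linearPl linearP /=.
by rewrite scalerDr !scalerA mulrC.
Qed.

Lemma braided_mul_pure b c b' c' :
  amul (braided_tens_alg HB x) ((b ⊠ c) ⊠ (b' ⊠ c')) =
  (amul HB <⊗> amul HB) (tassocV B B (B ⊗ B) (b ⊠ tassoc B B B
     ((idl <⊗> act x) (swap12 B B K (c ⊠ coact x b')) ⊠ c'))).
Proof. by rewrite /= lcompE on23E /braiding !lcompE tmapE idlE. Qed.

(** The braiding moves c past b'^0 and acts on it by b'^1; the coaction of the
    product b b'^0 then splits because B is a comodule algebra, which leaves b'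
    coacted upon twice. *)
Lemma coact_left_braided_mul r b c b' c' : homog r c ->
  coact_left x (amul (braided_tens_alg HB x) ((b ⊠ c) ⊠ (b' ⊠ c'))) =
  mul_side c c' (coact x b) ((coact x <⊗> idl) (coact x b')).
Proof.
move=> hc; rewrite braided_mul_pure.
elim/tens_homog_ind: (coact x b') => [|s t hs ht|i j y z hy hz].
- by rewrite !(linear0, linear0l).
- by rewrite !(linearD, linearDl) hs ht.
rewrite (swap12_homog _ hc hy) !(linearZl_LR, linearZ) /= !tmapE !idlE.
rewrite tassocE tassocVE tmapE coact_left.unlock lcompE tmapE idlE.
rewrite (mul_sideE _ _ _ hc (even_homog (coact_even hcomod) hy)).
by rewrite (proj1 (ca_comodule_alg (bh_crossed_alg hB))).
Qed.

Lemma biproduct_mul_pure q c y b :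
  mbip ((q ⊠ c) ⊠ (y ⊠ b)) =
  ((amul H <⊗> (amul HB ∘ (act x <⊗> idl) ∘ tassocV B K B))
    ∘ swap23 K B K (K ⊗ B)) ((q ⊠ c) ⊠ tassoc K K B (comul H y ⊠ b)).
Proof.
by rewrite /mbip /= [in LHS]lcompE tmapE idlE !lcompE tmapE idlE.
Qed.

(** The biproduct product lets c be acted upon by the second half of the
    coproduct of b'^1, while b and b' meet in the first two factors. *)
Lemma coact_left_tens_mul r b c b' c' : homog r c ->
  amul (tens_alg HB (biproduct_alg H HB x))
    (coact_left x (b ⊠ c) ⊠ coact_left x (b' ⊠ c')) =
  mul_side c c' (coact x b)
    (tassocV B K K ((idl <⊗> comul H) (coact x b'))).
Proof.
move=> hc; rewrite tens_alg_mulE -/mbip !coact_left_pure.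
elim/tens_homog_ind: (coact x b') => [|s t hs ht|i j y z hy hz].
- by rewrite !(linear0, linear0l).
- by rewrite !(linearD, linearDl) hs ht.
elim/tens_homog_ind: (coact x b) => [|s t hs ht|l m p q hp hq].
  (* For f linear, f 0 = f (-1 *: 0 + 0) = -1 *: f 0 + f 0 = 0. *)
- have := mul_side_linear c' (tassocV B K K
    ((idl <⊗> comul H) (y ⊠ z))) hc (-1) 0 0.
  rewrite /= scaler0 addr0 scaleN1r addNr => ->.
  by rewrite !(linear0, linear0l).
- rewrite -[s in RHS]scale1r (mul_side_linear c' _ hc) scale1r -hs -ht.
  by rewrite !(linearD, linearDl).
rewrite !tassocE (swap23_homog _ _ (homog_pure hq hc) hy) linearZ /= !tmapE idlE.
rewrite biproduct_mul_pure lcompE.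
elim/tens_homog_ind: (comul H z) => [|s t hs ht|i1 i2 z1 z2 hz1 hz2].
- by rewrite !(linear0, linear0l, scaler0).
- by rewrite ![in RHS]linearD -hs -ht !(linearD, linearDl).
rewrite tassocVE (mul_sideE _ _ _ hc (homog_pure hy hz1)).
rewrite /mBK tens_alg_mulE (swap23_homog _ _ hq hy) tassocE.
rewrite (swap23_homog _ _ hc hz1) !(linearZ, linearZl_LR) /= !tmapE.
rewrite tassocE !lcompE tassocVE !tmapE idlE !linearZ /= !scalerA.
(* Both sides collect |c||y|, |q||y| and |c||z1| as exponents. *)
congr (_ *: _); rewrite -!signr_addb; congr (_ ^+ _).
by case: (m) (r) (i) (i1) => [] [] [] [].
Qed.

(** The two previous lemmas meet by coassociativity of the coaction. *)
Lemma coact_left_mul s t :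
  coact_left x (amul (braided_tens_alg HB x) (s ⊠ t)) =
  amul (tens_alg HB (biproduct_alg H HB x)) (coact_left x s ⊠ coact_left x t).
Proof.
elim/tens_homog_ind: s => [|s s' hs hs'|_ r b c _ hc].
- by rewrite !(linear0, linear0l).
- by rewrite !(linearD, linearDl) hs hs'.
elim/tens_homog_ind: t => [|t t' ht ht'|_ _ b' c' _ _].
- by rewrite !linear0.
- by rewrite !linearD ht ht'.
rewrite (coact_left_braided_mul _ _ _ hc) (coact_left_tens_mul _ _ _ hc).
by rewrite -(coact_comul hcomod) tassocVK.
Qed.

Lemma canonical_coaction_hom :
  alg_hom HB (tens_alg HB (biproduct_alg H HB x)) (canonical_coaction HB x).
Proof.
have [comulM comul1] := bh_comul hB.
have [_ coact1] := ca_comodule_alg (bh_crossed_alg hB).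
split=> [b c|]; first by rewrite !canonical_coactionE comulM coact_left_mul.
by rewrite canonical_coactionE comul1 coact_left_pure coact1 tassocE.
Qed.

(** * The canonical coaction is a coaction of the biproduct *)

Lemma canonical_coaction_even :
  even_map (comul HB) -> even_map (canonical_coaction HB x).
Proof.
move=> eB; do !apply: even_lcomp => //; first exact: even_tassoc.
by apply: even_tmap; [apply: coact_even hcomod|apply: even_idl].
Qed.

Lemma coact_left_counit t :
  contractr B (counit (biproduct_coalg H HB x)) (coact_left x t) =
  contractr B (counit HB) t.
Proof.
elim/tens_ind: t => [|b c|s t hs ht]; first by rewrite !linear0.
  rewrite coact_left_pure contractrE -[b in RHS](coact_counit hcomod).
  elim/tens_ind: (coact x b) => [|y a|s t hs ht].
  - by rewrite !(linear0, linear0l).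
  - by rewrite tassocE !contractrE /= contractlE linearZ /= scalerA mulrC.
  - by rewrite !(linearD, linearDl) /= hs ht.
by rewrite !linearD /= hs ht.
Qed.

(** ((x (x) a1) (x) a2) |-> +/- (x (x) a1 (x) y^0) (x) (a2 y^1 (x) z), where y
    stands for a coaction value y^0 (x) y^1.  Up to reassociation, both sides
    of the comodule axiom are values of this map, on the two sides of
    coassociativity of the coaction. *)
Definition comul_side (y : B ⊗ K) (z : B) :
    {linear (B ⊗ K) ⊗ K -> B ⊗ (K ⊗ B) ⊗ (K ⊗ B)} :=
  (tassoc B K B <⊗> ((amul H <⊗> idl) ∘ tassocV K K B))
  ∘ swap23 (B ⊗ K) K B (K ⊗ B) ∘ applyr (@pure k _ _) (tassoc B K B (y ⊠ z)).

Lemma comul_sideE i j y0 y1 z s a : homog i y0 -> homog j a ->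
  comul_side (y0 ⊠ y1) z (s ⊠ a) = (-1) ^+ (j && i) *:
  (tassoc B K B (s ⊠ y0) ⊠ (amul H (a ⊠ y1) ⊠ z)).
Proof.
move=> hy ha; rewrite /comul_side !lcompE /= tassocE.
by rewrite (swap23_homog _ _ ha hy) linearZ /= tmapE lcompE tassocVE tmapE idlE.
Qed.

Let shuffle : {linear (K ⊗ K) ⊗ (B ⊗ (K ⊗ B)) -> (K ⊗ B) ⊗ (K ⊗ B)} :=
  (idl <⊗> ((amul H <⊗> idl) ∘ tassocV K K B)) ∘ swap23 K K B (K ⊗ B).

(** [outer] and [inner] are the two sides of the comodule axiom, as functions of
    the threefold braided coproduct bracketed to the left and to the right. *)
Let outer : {linear B ⊗ B ⊗ B -> B ⊗ ((K ⊗ B) ⊗ (K ⊗ B))} :=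
  tassoc B (K ⊗ B) (K ⊗ B) ∘ (coact_left x <⊗> idl) ∘ tassoc (B ⊗ B) K B
  ∘ (coact (tens_crossed H x x) <⊗> idl).

Let inner : {linear B ⊗ (B ⊗ B) -> B ⊗ ((K ⊗ B) ⊗ (K ⊗ B))} :=
  (idl <⊗> (shuffle ∘ (comul H <⊗> idl))) ∘ tassoc B K (B ⊗ (K ⊗ B))
  ∘ (coact x <⊗> coact_left x).

(** Applying the coaction to b_1^0 needs the coproduct of b_1^0; as the braided
    coproduct is a comodule map, it is the coaction on the coproduct of b_1. *)
Lemma coaction_twice t :
  tassoc B (K ⊗ B) (K ⊗ B)
    ((canonical_coaction HB x <⊗> idl) (coact_left x t)) =
  outer ((comul HB <⊗> idl) t).
Proof.
elim/tens_ind: t => [|b z|s t hs ht]; first by rewrite !linear0.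
  rewrite tmapE idlE /outer !lcompE tmapE idlE coact_left_pure.
  rewrite (cmor_coact (bh_comul_mor hB)).
  elim/tens_ind: (coact x b) => [|y a|s t hs ht].
  - by rewrite !(linear0, linear0l).
  - by rewrite tassocE !tmapE !idlE tassocE tmapE canonical_coactionE idlE.
  - by rewrite !(linearD, linearDl) /= hs ht.
by rewrite !linearD /= hs ht.
Qed.

Lemma coaction_comul t :
  (idl <⊗> comul (biproduct_coalg H HB x)) (coact_left x t) =
  inner ((idl <⊗> comul HB) t).
Proof.
elim/tens_ind: t => [|b z|s t hs ht]; first by rewrite !linear0.
  rewrite tmapE idlE /inner !lcompE tmapE coact_left_pure.
  elim/tens_ind: (coact x b) => [|y a|s t hs ht].
  - by rewrite !(linear0, linear0l).
  - rewrite !tassocE !tmapE !idlE /shuffle !lcompE !tmapE.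
    by rewrite canonical_coactionE idlE.
  - by rewrite !(linearD, linearDl) /= hs ht.
by rewrite !linearD /= hs ht.
Qed.

Lemma outer_inner w : outer w = inner (tassoc B B B w).
Proof.
elim/tens_ind: w => [|t z|s t hs ht]; first by rewrite !linear0.
  elim/tens_ind: t => [|p q|s t hs ht].
  - by rewrite !(linear0, linear0l).
  - rewrite /outer /inner tassocE !lcompE !tmapE !lcompE tmapE idlE coact_left_pure.
    elim/tens_homog_ind: (coact x q) => [|s t hs ht|i j y0 y1 hy0 hy1].
    + by rewrite !(linear0, linear0l).
    + by rewrite !(linearD, linearDl) /= hs ht.
    (* Here the tensor square coacts on p (x) q, and p is coacted upon twice. *)
    transitivity (tassoc B (K ⊗ B) (K ⊗ B)
        (comul_side (y0 ⊠ y1) z ((coact x <⊗> idl) (coact x p)))).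
      elim/tens_homog_ind: (coact x p) => [|s t hs ht|l m x0 x1 hx0 hx1].
      + by rewrite !(linear0, linear0l).
      + by rewrite !(linearD, linearDl) /= hs ht.
      rewrite (swap23_homog _ _ hx1 hy0) !tmapE !idlE (comul_sideE _ _ _ hy0 hx1).
      rewrite !(linearZ, linearZl_LR) /= tmapE idlE tassocE tmapE idlE.
      by rewrite coact_left_pure.
    rewrite -[(coact x <⊗> idl) _]tassocVK (coact_comul hcomod).
    elim/tens_homog_ind: (coact x p) => [|s t hs ht|_ _ x0 x1 _ _].
    + by rewrite !(linear0, linear0l).
    + by rewrite !(linearD, linearDl) /= hs ht.
    rewrite !tassocE !tmapE !idlE ![in RHS]lcompE tmapE idlE.
    elim/tens_homog_ind: (comul H x1) => [|s t hs ht|l m a1 a2 ha1 ha2].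
    + by rewrite !(linear0, linear0l).
    + by rewrite !(linearD, linearDl) /= hs ht.
    rewrite tassocVE (comul_sideE _ _ _ hy0 ha2) !(linearZ, linearZl_LR) /=.
    rewrite !tassocE (swap23_homog _ _ ha2 hy0).
    by rewrite !linearZ /= tmapE idlE lcompE tassocVE tmapE idlE.
  by rewrite !(linearD, linearDl) /= hs ht.
by rewrite !linearD /= hs ht.
Qed.

Lemma canonical_coaction_comodule :
  right_comodule (biproduct_coalg H HB x) (canonical_coaction HB x).
Proof.
have cB := bh_coalg hB; split=> [b|b|].
- rewrite canonical_coactionE coaction_twice coaction_comul outer_inner.
  by rewrite (comul_assoc cB).
- by rewrite canonical_coactionE coact_left_counit (comul_counitr cB).
- exact: canonical_coaction_even (comul_even cB).
Qed.
End Biproduct.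

(** * Degree and differential *)
Section Graded.
Variable k : fieldType.
Implicit Types U V W : gradedType k.

Lemma degree_idl V : degree_preserving (@idl k V).
Proof. by move=> n v; rewrite !idlE. Qed.

Lemma degree_lcomp U V W (g : {linear V -> W}) (f : {linear U -> V}) :
  degree_preserving g -> degree_preserving f -> degree_preserving (g ∘ f).
Proof. by move=> hg hf n v; rewrite !lcompE hf hg. Qed.

Lemma degree_tmap V V' W W' (f : {linear V -> V'}) (g : {linear W -> W'}) :
  degree_preserving f -> degree_preserving g -> degree_preserving (f <⊗> g).
Proof.
move=> hf hg n; elim/tens_grd_ind => [|i j v w|x y hx hy].
- by rewrite !linear0.
- rewrite /grd /= tgrd_pure tmapE hf hg tgrd_pure.
  by case: ifP => _; rewrite ?linear0 // tmapE hf hg.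
- by rewrite !linearD hx hy.
Qed.

Lemma grd_pure_grd V W n i j (v : V) (w : W) : grd n (grd i v ⊠ grd j w) =
  if n == (i + j)%N then grd i v ⊠ grd j w else 0.
Proof. exact: tgrd_pure. Qed.

Lemma degree_tassoc U V W : degree_preserving (tassoc U V W).
Proof.
move=> n; elim/tens_grd_ind => [|i j t w|x y hx hy].
- by rewrite !linear0.
- elim/tens_grd_ind: t => [|l m u v|x y hx hy].
  + by rewrite !(linear0, linear0l).
  + rewrite [grd i _]grd_pure_grd; case: eqP => _; last first.
      by rewrite !(linear0, linear0l).
    have euv : grd l u ⊠ grd m v = grd (l + m) (grd l u ⊠ grd m v).
      by rewrite grd_pure_grd eqxx.
    have evw : grd m v ⊠ grd j w = grd (m + j) (grd m v ⊠ grd j w).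
      by rewrite grd_pure_grd eqxx.
    rewrite euv grd_pure_grd -euv tassocE evw [grd n _]grd_pure_grd -evw addnA.
    by case: ifP; rewrite ?tassocE ?linear0.
  + by rewrite !(linearD, linearDl) hx hy.
- by rewrite !linearD hx hy.
Qed.

End Graded.

Section Differential.
Variable k : fieldType.
Implicit Types U V W : superType k.

Lemma sgn_pure V W (v : V) (w : W) : sgn (v ⊠ w) = sgn v ⊠ sgn w.
Proof.
have e b c : sgn (par b v ⊠ par c w) = sgn (par b v) ⊠ sgn (par c w).
  rewrite (sgn_homog (homog_pure (homog_par b v) (homog_par c w))).
  rewrite !(sgn_homog (homog_par _ _)) linearZl_LR linearZ /= scalerA.
  by rewrite -signr_addb addbC.
move: (@sgn k (V ⊗ W)) (@sgn k V) (@sgn k W) e => f g h e.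
rewrite -[v]par_sum -[w]par_sum !big_bool /=.
by rewrite (linearD g) (linearD h) !pureDl !pureDr !(linearD f) !e.
Qed.

Lemma tdiff_pure V W (dV : {linear V -> V}) (dW : {linear W -> W}) v w :
  tdiff dV dW (v ⊠ w) = dV v ⊠ w + sgn v ⊠ dW w.
Proof. by rewrite /tdiff /= !tmapE idlE. Qed.

Lemma tdiff_tassoc U V W (dU : {linear U -> U}) (dV : {linear V -> V})
    (dW : {linear W -> W}) t :
  tassoc U V W (tdiff (tdiff dU dV) dW t) =
  tdiff dU (tdiff dV dW) (tassoc U V W t).
Proof.
elim/tens_ind: t => [|t w|s t hs ht]; first by rewrite !linear0.
  elim/tens_ind: t => [|u v|s t hs ht].
  - by rewrite !(linear0, linear0l).
  - rewrite tassocE !tdiff_pure sgn_pure; move: (sgn u) (sgn v) => u' v'.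
    by rewrite linearDl !linearD /= !tassocE addrA.
  - move: (tdiff (tdiff _ _) _) (tdiff _ (tdiff _ _)) hs ht => D D' hs ht.
    by rewrite pureDl !linearD hs ht.
move: (tdiff (tdiff _ _) _) (tdiff _ (tdiff _ _)) hs ht => D D' hs ht.
by rewrite !linearD hs ht.
Qed.

(** f must be even because the second term of the tensor differential carries
    the parity of the first factor. *)
Lemma tdiff_tmap V V' W W' (dV : {linear V -> V}) (dV' : {linear V' -> V'})
    (dW : {linear W -> W}) (dW' : {linear W' -> W'})
    (f : {linear V -> V'}) (g : {linear W -> W'}) :
  even_map f -> (forall v, f (dV v) = dV' (f v)) ->
  (forall w, g (dW w) = dW' (g w)) ->
  forall t, (f <⊗> g) (tdiff dV dW t) = tdiff dV' dW' ((f <⊗> g) t).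
Proof.
move=> ef hf hg; elim/tens_ind => [|v w|s t hs ht]; first by rewrite !linear0.
  rewrite tmapE !tdiff_pure -(even_sgn _ ef); move: (sgn v) => v'.
  by rewrite linearD /= !tmapE hf hg.
move: (tdiff dV dW) (tdiff dV' dW') hs ht => D D' hs ht.
by rewrite !linearD hs ht.
Qed.

End Differential.

Theorem corollary4p3 (k : fieldType)
    (A B : superType k) (OA OB : gradedType k)
    (HA : hopf_data A) (HB : hopf_data B) (xB : crossed_data A B)
    (HOA : hopf_data OA) (eA : ext_data A OA)
    (HOB : hopf_data OB) (xOB : crossed_data OA OB) (eB : ext_data B OB)
    (hA : hopf_algebra HA)
    (hB0 : concentrated_in_degree_0 B)
    (hB : braided_hopf HA HB xB)
    (hOA : strongly_bicovariant HA HOA eA)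
    (hOB : braided_strongly_bicovariant HA HOA eA HB xB HOB xOB eB) :
  differentiable
    HB HOB eB
    (biproduct_alg HA HB xB) (biproduct_coalg HA HB xB)
    (biproduct_alg HOA HOB xOB) (biproduct_ext eA eB)
    (canonical_coaction HB xB).
Proof.
split; first exact: canonical_coaction_comodule hB.
  exact: canonical_coaction_hom hB.
have [coact_ext coact_deg _ coact_d] := bsb_coact hOB.
exists (canonical_coaction HOB xOB); split.
- move=> b; rewrite !canonical_coactionE (bsb_comul_extends hOB).
  elim/tens_ind: (comul HB b) => [|c z|s t hs ht]; first by rewrite !linear0.
    rewrite tmapE !coact_left_pure coact_ext.
    elim/tens_ind: (coact xB c) => [|y a|s t hs ht].
    + by rewrite !(linear0, linear0l).
    + by rewrite tmapE !tassocE !tmapE.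
    + by rewrite !(linearD, linearDl) /= hs ht.
  by rewrite !linearD /= hs ht.
- apply: degree_lcomp (bsb_comul_degree hOB).
  apply: degree_lcomp; first exact: degree_tassoc.
  exact: degree_tmap coact_deg (@degree_idl _ _).
- exact: canonical_coaction_hom (bsb_braided hOB).
- move=> w; rewrite !canonical_coactionE (bsb_comul_diff hOB) coact_left.unlock.
  have xO := ca_crossed (bh_crossed_alg (bsb_braided hOB)).
  have ev := coact_even (cm_comodule xO).
  rewrite !lcompE -tdiff_tassoc; congr (tassoc _ _ _ _).
  by apply: tdiff_tmap => // v; rewrite !idlE.
Qed.
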